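(* There exists a continuous 2-valued dynamics $T:\mathbb{C}\to\mathrm{Sym}^2(\mathbb{C})$ that is not strongly invertible and that is defined by the action of some 2-valued group.
   Context: Square brackets denote multisets. For a set $S$, $\mathrm{Sym}^m(S)=S^m/\mathfrak{S}_m$ is the $m$-th symmetric power (multisets of $m$ elements of $S$); if $S$ is a topological space, $\mathrm{Sym}^m(S)$ has the quotient topology. A (continuous) $m$-valued dynamics on $S$ is a (continuous) map $T:S\to\mathrm{Sym}^m(S)$. Strong invertibility: let $G$ be the directed multigraph with vertex set $S$ in which the edge $(s_1,s_2)$ occurs as many times as $s_2$ occurs in the multiset $T(s_1)$. $T$ is strongly invertible if every vertex $s$ has exactly $m$ incoming edges (counted with multiplicity). $m$-valued group: a set $X$ with a map $\mu:X\times X\to\mathrm{Sym}^m(X)$, written $x*y$, an element $e$ and a map $\mathrm{inv}:X\to X$ such that: (associativity) the $m^2$-element multisets $x*(y*z)$ and $(x*y)*z$ (obtained by multiplying elementwise and taking multiset union) are equal for all $x,y,z$; (unit) $e*x=x*e=[x,\dots,x]$ for all $x$; (inverse) $e\in \mathrm{inv}(x)*x$ and $e\in x*\mathrm{inv}(x)$ for all $x$. Action: an $m$-valued group $A$ acts on a topological space $S$ via $\nu:A\times S\to\mathrm{Sym}^m(S)$ if (1) for all $a_1,a_2\in A$, $s\in S$ the $m^2$-element multisets $\nu(a_1,\nu(a_2,s))$ and $\nu(a_1*a_2,s)$ (multiset unions) are equal; (2) $\nu(e,s)=[s,\dots,s]$ for all $s$; and, in the continuous setting, (3) for each $a\in A$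 the map $\nu(a,\cdot):S\to\mathrm{Sym}^m(S)$ is continuous. An $m$-valued dynamics $T$ on $S$ is defined by the action of an $m$-valued group if there exist an $m$-valued group $A$, an element $a\in A$ and an action $\nu$ of $A$ on $S$ with $T(s)=\nu(a,s)$ for all $s\in S$. *)

(* Defs.v *)
From HB Require Import structures.
From mathcomp Require Import all_boot all_order all_algebra.
From mathcomp Require Import all_classical all_reals all_analysis.
From mathcomp Require Import fingroup perm generic_quotient complex.
Import numFieldNormedType.Exports.

Set Implicit Arguments.
Unset Strict Implicit.
Unset Printing Implicit Defensive.

Local Open Scope classical_set_scope.
Local Open Scope quotient_scope.

(* The topology of the norm |x + iy| = sqrt (x^2 + y^2) on the complex numbers,
   as for any numFieldType. *)
HB.instance Definition _ (R : realType) := NormedModule.copy R[i] R[i]^o.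

(* Symmetric powers.  S^m is ['I_m -> S], with 'S_m permuting the
   coordinates; [S] is only asked to be a choiceType, a structure that
   every type carries classically. *)
Section Sym.
Context (m : nat) (S : choiceType).

Definition sym_rel : rel ('I_m -> S) :=
  fun x y => [exists s : 'S_m, [forall i, x (s i) == y i]].

Lemma sym_relP (x y : 'I_m -> S) :
  reflect (exists s : 'S_m, forall i, x (s i) = y i) (sym_rel x y).
Proof.
apply: (iffP existsP) => -[s H]; exists s.
  by move=> i; apply/eqP; move/forallP: H; apply.
by apply/forallP => i; apply/eqP.
Qed.

Lemma sym_rel_refl : reflexive sym_rel.
Proof. by move=> x; apply/sym_relP; exists 1%g => i; rewrite perm1. Qed.

Lemma sym_rel_sym : symmetric sym_rel.
Proof.
suff imp x y : sym_rel x y -> sym_rel y x by move=> x y; apply/idP/idP; exact: imp.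
by move=> /sym_relP[s H]; apply/sym_relP; exists (s^-1)%g => i; rewrite -H permKV.
Qed.

Lemma sym_rel_trans : transitive sym_rel.
Proof.
move=> y x z /sym_relP[s Hs] /sym_relP[t Ht]; apply/sym_relP.
by exists (t * s)%g => i; rewrite permM Hs Ht.
Qed.

Canonical sym_equiv := EquivRel sym_rel sym_rel_refl sym_rel_sym sym_rel_trans.

Definition Sym : Type := {eq_quot sym_equiv}.

HB.instance Definition _ := Choice.on Sym.
HB.instance Definition _ := EqQuotient.on Sym.

(* The elements of a multiset in an arbitrary order: to be used up to
   [perm_eq], see [sym_seq_pi]. *)
Definition sym_seq (x : Sym) : seq S := codom (repr x).

Definition sym_mult (x : Sym) (s : S) : nat := count_mem s (sym_seq x).

Definition sym_const (s : S) : Sym := \pi_Sym (fun=> s).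

Lemma sym_rel_codom (x y : 'I_m -> S) : sym_rel x y = perm_eq (codom x) (codom y).
Proof.
have codomT (z : 'I_m -> S) : codom z = [tuple z i | i < m] by [].
rewrite perm_sym !codomT; apply/sym_relP/tuple_permP => -[s xsy]; exists s.
  by apply: eq_codom => i; rewrite tnth_mktuple.
move=> i; have /(congr1 (fun t => tnth t i)) := val_inj xsy.
by rewrite !tnth_mktuple.
Qed.

Lemma sym_seq_pi (x : 'I_m -> S) : perm_eq (sym_seq (\pi_Sym x)) (codom x).
Proof. by rewrite -sym_rel_codom; apply/eqmodP; rewrite reprK. Qed.

Lemma sym_seq_inj (x y : Sym) : perm_eq (sym_seq x) (sym_seq y) -> x = y.
Proof. by rewrite -sym_rel_codom => /eqmodP; rewrite !reprK. Qed.

End Sym.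


(* The multiset union of the [f x] for [x] in [u]. *)
Definition sym_bind (m n : nat) (S S' : choiceType)
    (u : Sym m S) (f : S -> Sym n S') : seq S' :=
  flatten [seq sym_seq (f x) | x <- sym_seq u].

(* Continuity into Sym^m(S), for the quotient of the product topology on S^m. *)
Definition sym_continuous (m : nat) (X S : topologicalType)
    (f : X -> Sym m S) : Prop :=
  continuous (f : X -> @quotient_topology {ptws 'I_m -> S} (Sym m S)).

Section StrongInvertibility.
Context (m : nat) (S : choiceType) (T : S -> Sym m S).

(* The edges of the multigraph of [T] that end at [s]: the pair [(s1, k)] is
   the [k]-th copy of the edge [(s1, s)]. *)
Definition incoming_edges (s : S) : set (S * nat) :=
  [set e | (e.2 < sym_mult (T e.1) s)%N].

Definition strongly_invertible : Prop :=
  forall s : S, (incoming_edges s #= `I_m)%card.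

End StrongInvertibility.

Record mvgroup (m : nat) := MVGroup {
  mvg_sort :> choiceType;
  mvg_mul : mvg_sort -> mvg_sort -> Sym m mvg_sort;
  mvg_one : mvg_sort;
  mvg_inv : mvg_sort -> mvg_sort;
  mvg_mulA : forall x y z,
    perm_eq (sym_bind (mvg_mul y z) (fun w => mvg_mul x w))
            (sym_bind (mvg_mul x y) (fun w => mvg_mul w z));
  mvg_mul1r : forall x, mvg_mul mvg_one x = sym_const m x;
  mvg_mulr1 : forall x, mvg_mul x mvg_one = sym_const m x;
  mvg_mulVr : forall x, mvg_one \in sym_seq (mvg_mul (mvg_inv x) x);
  mvg_mulrV : forall x, mvg_one \in sym_seq (mvg_mul x (mvg_inv x))
}.

Record mvaction (m : nat) (A : mvgroup m) (S : topologicalType) := MVAction {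
  mva_fun :> A -> S -> Sym m S;
  mva_mul : forall (a1 a2 : A) (s : S),
    perm_eq (sym_bind (mva_fun a2 s) (fun t => mva_fun a1 t))
            (sym_bind (mvg_mul a1 a2) (fun b => mva_fun b s));
  mva_one : forall s : S, mva_fun (mvg_one A) s = sym_const m s;
  mva_continuous : forall a : A, sym_continuous (mva_fun a)
}.

Definition defined_by_action (m : nat) (S : topologicalType)
    (T : S -> Sym m S) : Prop :=
  exists (A : mvgroup m) (a : A) (nu : mvaction A S), forall s, T s = nu a s.

(* Main.v *)
Require Import Defs.
From mathcomp Require Import all_boot all_order all_algebra.
From mathcomp Require Import all_classical all_reals all_analysis complex.
From mathcomp Require Import generic_quotient ring.

(** Let the group {1, -1} act on the additive group of complex numbers by
    u |-> - u.  The orbit space, with the addition it inherits, is a 2-valued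
    group; squaring identifies it with the complex plane, and the
    multiplication becomes
      x * y = [(sqrt x + sqrt y)^2, (sqrt x - sqrt y)^2],
    a multiset that does not depend on the chosen square roots.
    Associativity of this product is literally the compatibility axiom for
    the left multiplication of the 2-valued group on itself, so every map
    T_a(z) = a * z is defined by an action.

    T_a is continuous because u |-> T_a(u^2) is visibly continuous and
    continuity descends along the squaring map ([continuous_sqr_descent]); the
    discontinuity of the square root never enters.

    T = T_1 is not strongly invertible.  An edge z -> 0 requires
    sqrt z = 1 or sqrt z = - 1, hence z = 1; but T(1) = [4, 0] contains 0 only
    once.  The ramification point 0 thus has a single incoming edge instead of
    two.  *)

Set Implicit Arguments.
Unset Strict Implicit.
Unset Printing Implicit Defensive.

Import Order.TTheory GRing.Theory Num.Theory.

Local Open Scope classical_set_scope.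
Local Open Scope quotient_scope.
Local Open Scope ring_scope.

(** * Multisets with two elements *)

Section UnorderedPairs.
Context {S : choiceType}.

Definition sym_pair (s t : S) : Sym 2 S :=
  \pi_(Sym 2 S) (fun i : 'I_2 => if i == ord0 then s else t).

Lemma sym_seq_pair s t : perm_eq (sym_seq (sym_pair s t)) [:: s; t].
Proof.
by rewrite (permPl (sym_seq_pi _)) /codom /image_mem !enum_ordSl enum_ord0.
Qed.

Lemma sym_pairC s t : sym_pair s t = sym_pair t s.
Proof.
apply: sym_seq_inj; rewrite (permPl (sym_seq_pair _ _)) perm_sym.
by rewrite (permPl (sym_seq_pair _ _)) (perm_catC [:: t] [:: s]).
Qed.

Lemma sym_pair_const s : sym_pair s s = sym_const 2 s.
Proof. by congr (\pi_(Sym 2 S) _); apply/funext => i; case: ifP. Qed.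

Lemma mem_sym_pair x s t : (x \in sym_seq (sym_pair s t)) = (x == s) || (x == t).
Proof. by rewrite (perm_mem (sym_seq_pair s t)) !inE. Qed.

Lemma sym_mult_pair x s t : sym_mult (sym_pair s t) x = ((s == x) + (t == x))%N.
Proof. by rewrite /sym_mult (permP (sym_seq_pair s t)) /= addn0. Qed.

Lemma sym_bind_pair (S' : choiceType) s t (f : S -> Sym 2 S') :
  perm_eq (sym_bind (sym_pair s t) f) (sym_seq (f s) ++ sym_seq (f t)).
Proof.
rewrite /sym_bind (permPl (perm_flatten (perm_map _ (sym_seq_pair s t)))) /=.
by rewrite cats0.
Qed.

End UnorderedPairs.

Lemma sym_pair_continuous (X S : topologicalType) (f g : X -> S) :
  continuous f -> continuous g ->
  sym_continuous (fun x => sym_pair (f x) (g x)).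
Proof.
move=> cf cg x.
pose h y : {ptws 'I_2 -> S} := fun i : 'I_2 => if i == ord0 then f y else g y.
have ch : {for x, continuous h}.
  (* The product topology is the supremum of the topologies of the projections. *)
  apply/cvg_sup => i U [V] [[W oW <-] Wh WU].
  apply: (filterS WU).
  have : (fun y => h y i) @ x --> h x i.
    by rewrite /h; case: ifP => _; [exact: cf|exact: cg].
  by apply; apply: open_nbhs_nbhs.
apply: continuous_comp ch _.
exact: pi_continuous.
Qed.

(** * The 2-valued group on the orbits of u |-> - u *)

Section SquareCosets.
Context {K : numClosedFieldType}.

Definition sqmul (x y : K) : Sym 2 K :=
  sym_pair ((sqrtC x + sqrtC y) ^+ 2) ((sqrtC x - sqrtC y) ^+ 2).

(** Replacing a square root by its opposite only exchanges the two values, so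
    any square roots may be used; all identities on [sqmul] are then
    identities between polynomials in the roots. *)
Lemma sqmul_sqr (u v : K) :
  sqmul (u ^+ 2) (v ^+ 2) = sym_pair ((u + v) ^+ 2) ((u - v) ^+ 2).
Proof.
have sqrtC_sqr (w : K) : sqrtC (w ^+ 2) = w \/ sqrtC (w ^+ 2) = - w.
  by have /eqP := sqrtCK (w ^+ 2); rewrite eqf_sqr => /orP[] /eqP; [left|right].
rewrite /sqmul; case: (sqrtC_sqr u) => ->; case: (sqrtC_sqr v) => -> //.
- by rewrite opprK sym_pairC.
- by rewrite sym_pairC; congr sym_pair; ring.
- by congr sym_pair; ring.
Qed.

(** Both sides consist of the squares of the four sums u + v + w, u + v - w,
    u - v + w, u - v - w, where u, v, w are square roots of x, y, z. *)
Lemma sqmulA (x y z : K) :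
  perm_eq (sym_bind (sqmul y z) (fun w => sqmul x w))
          (sym_bind (sqmul x y) (fun w => sqmul w z)).
Proof.
rewrite -[x]sqrtCK -[y]sqrtCK -[z]sqrtCK.
set u := sqrtC x; set v := sqrtC y; set w := sqrtC z.
rewrite !sqmul_sqr !(permPl (sym_bind_pair _ _ _)) perm_sym.
rewrite !(permPl (sym_bind_pair _ _ _)) perm_sym !sqmul_sqr.
rewrite (permPl (perm_cat (sym_seq_pair _ _) (sym_seq_pair _ _))) perm_sym.
rewrite (permPl (perm_cat (sym_seq_pair _ _) (sym_seq_pair _ _))) perm_sym /=.
have -> : u + (v + w) = u + v + w by ring.
have -> : u - (v + w) = u - v - w by ring.
have -> : u + (v - w) = u + v - w by ring.
have -> : u - (v - w) = u - v + w by ring.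
(* It remains to rotate the last three squares. *)
by rewrite perm_cons (perm_catC [:: _] [:: _; _]).
Qed.

Lemma sqmul0r (x : K) : sqmul 0 x = sym_const 2 x.
Proof. by rewrite /sqmul sqrtC0 add0r sub0r sqrrN sqrtCK sym_pair_const. Qed.

Lemma sqmulr0 (x : K) : sqmul x 0 = sym_const 2 x.
Proof. by rewrite /sqmul sqrtC0 addr0 subr0 sqrtCK sym_pair_const. Qed.

Lemma sqmul_inv (x : K) : 0 \in sym_seq (sqmul x x).
Proof. by rewrite mem_sym_pair subrr expr0n eqxx orbT. Qed.

Definition sq_mvgroup : mvgroup 2 :=
  @MVGroup 2 K sqmul 0 id sqmulA sqmul0r sqmulr0 sqmul_inv sqmul_inv.

Lemma sqmul1_preim0 (x : K) : (0 < sym_mult (sqmul 1%R x) 0%R)%N -> x = 1.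
Proof.
rewrite sym_mult_pair sqrtC1 !sqrf_eq0 addr_eq0 subr_eq0 -[x in x = 1]sqrtCK.
rewrite (eq_sym 1 (- _)) eqr_oppLR ![1 == _]eq_sym.
case: eqP => [-> _|_]; first by rewrite sqrrN expr1n.
by case: eqP => // ->; rewrite expr1n.
Qed.

Lemma sqmul11_mult0 : sym_mult (sqmul (1 : K) 1) 0 = 1%N.
Proof.
by rewrite sym_mult_pair sqrtC1 subrr expr0n eqxx sqrf_eq0
  (_ : 1 + 1 = 2%:R) // pnatr_eq0.
Qed.

(** The only edge into 0 starts at 1 and is simple. *)
Lemma sqmul1_not_strongly_invertible : ~ strongly_invertible (sqmul (1 : K)).
Proof.
move=> /(_ 0).
have -> : incoming_edges (sqmul (1 : K)) 0 = [set (1, 0%N)].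
  rewrite eqEsubset; split => [[x k] /= kx|_ ->] /=; last first.
    by rewrite /incoming_edges /= sqmul11_mult0.
  rewrite /incoming_edges /= in kx.
  have x1 := sqmul1_preim0 (leq_ltn_trans (leq0n k) kx).
  by move: kx; rewrite x1 sqmul11_mult0 ltnS leqn0 => /eqP ->.
by rewrite (card_eql card_set1) => /card_eq_II.
Qed.

End SquareCosets.

(** * Continuity of the multiplication *)

(** Squaring is a quotient map.  If u^2 is at distance less than e^2 from w^2,
    then |u - w| * |u + w| < e^2, so u or - u is at distance less than e from
    w; both have the same square, so it does not matter which. *)
Lemma continuous_sqr_descent (R : realType) (Y : topologicalType) (f : R[i] -> Y) :
  continuous (fun u : R[i] => f (u ^+ 2)) -> continuous f.
Proof.
move=> cf z U; rewrite -{1}[z]sqrtCK => /cf /nbhs_ballP[e /= e0 eU].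
apply/nbhs_ballP; exists (e ^+ 2) => [|z' /=]; first by rewrite /= exprn_gt0.
rewrite -ball_normE /= -{1}[z]sqrtCK -[z']sqrtCK.
move: eU; rewrite -ball_normE /=; set w := sqrtC z; set w' := sqrtC z' => eU.
rewrite subr_sqr normrM => ww'.
have [we|ew] := real_ltP (normr_real (w - w')) (gtr0_real e0).
  exact: (eU w').
have -> : w' ^+ 2 = (- w') ^+ 2 by rewrite sqrrN.
apply: (eU (- w')); rewrite /= opprK.
have [//|ew'] := real_ltP (normr_real (w + w')) (gtr0_real e0).
(* Two factors that are both at least e contradict the bound e^2. *)
move: ww'; rewrite real_ltNge ?realM ?realX ?normr_real ?gtr0_real//.
by rewrite expr2 ler_pM // ltW.
Qed.

(** After the substitution z = u^2 the two values are the polynomials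
    (b + u)^2 and (b - u)^2 in u, where b is a square root of a. *)
Lemma sqmul_continuous (R : realType) (a : R[i]) : sym_continuous (sqmul a).
Proof.
apply: (@continuous_sqr_descent R (quotient_topology _)).
have sqmul_aE : (fun u => sqmul a (u ^+ 2)) =
    fun u => sym_pair ((sqrtC a + u) ^+ 2) ((sqrtC a - u) ^+ 2).
  by apply/funext => u; rewrite -{1}[a]sqrtCK sqmul_sqr.
suff : sym_continuous (fun u : R[i] => sqmul a (u ^+ 2)) by [].
have sqrC (g : R[i] -> R[i]) : continuous g -> continuous (fun u => g u ^+ 2).
  by move=> cg u; exact: cvgM (cg u) (cg u).
rewrite sqmul_aE; apply: sym_pair_continuous; apply: sqrC => u.
  exact: cvgD (cvg_cst _) (@cvg_id _ (nbhs u)).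
exact: cvgB (cvg_cst _) (@cvg_id _ (nbhs u)).
Qed.

Theorem theorem1p8 (R : realType) :
  exists T : R[i] -> Sym 2 R[i],
    [/\ sym_continuous T, ~ strongly_invertible T & defined_by_action T].
Proof.
exists (sqmul 1); split.
- exact: sqmul_continuous.
- exact: sqmul1_not_strongly_invertible.
(* The 2-valued group acts on itself by left multiplication. *)
- pose nu : mvaction (@sq_mvgroup R[i]) R[i] :=
    @MVAction 2 (@sq_mvgroup R[i]) R[i] sqmul sqmulA sqmul0r (@sqmul_continuous R).
  by exists sq_mvgroup, 1, nu.
Qed.
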